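(* Let $G$ and $G'$ be two valid bands, with column partitions $(P_1,P_2,P_3)$ and $(P_1',P_2',P_3')$ respectively. If the multisets $\{\!\{P_1,P_2,P_3\}\!\}$ and $\{\!\{P_1',P_2',P_3'\}\!\}$ are isomorphic, then $G$ and $G'$ have the same number of completions to a complete Sudoku grid. In other words, the number of completions of a band to a complete Sudoku grid depends only on the isomorphism class of the multiset of its column partitions.
   Context: A complete Sudoku grid is a filling of a $9\times 9$ array with digits from $\{1,\dots,9\}$ such that each digit occurs exactly once in each row, in each column, and in each of the nine $3\times 3$ blocks (the blocks being the intersections of the row groups $\{1,2,3\},\{4,5,6\},\{7,8,9\}$ with the column groups $\{1,2,3\},\{4,5,6\},\{7,8,9\}$). A (valid) band is a filling of a $3\times 9$ array (thought of as the first three rows of a Sudoku grid) with digits from $\{1,\dots,9\}$ such that each digit occurs exactly once in each of the three rows and exactly once in each of the three $3\times 3$ blocks $B_1,B_2,B_3$ (columns $1$–$3$, $4$–$6$, $7$–$9$). A completion of a band is a complete Sudoku grid whose first three rows are the band. The column partition $P_i$ of block $B_i$ is the (unordered) partition of $\{1,\dots,9\}$ into three sets of size $3$ whose members are the sets of digits appearing in the three columns of $B_i$. The multiset $\{\!\{P_1,P_2,P_3\}\!\}$ is the unordered collection of the three column partitions, counted with multiplicity. A bijection $\sigma\in S_9$ of $\{1,\dots,9\}$ acts on partitions by applying $\sigma$ to every element of every part, and hence acts on multisets of three partitions. Two such multisets are isomorphic if some $\sigma\in S_9$ transforms one into the other. *)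

(* Defs.v *)
From mathcomp Require Import all_boot all_algebra all_fingroup.

Set Implicit Arguments.
Unset Strict Implicit.
Unset Printing Implicit Defensive.

(* Rows, columns and digits are numbered from 0, so the digits
   1, ..., 9 are represented by the elements of 'I_9. *)

Notation digit := 'I_9.
Notation band := 'M[digit]_(3, 9).
Notation grid := 'M[digit]_9.

Definition exactly_once m n (A : 'M[digit]_(m, n)) (C : {set 'I_m * 'I_n})
    (d : digit) : bool :=
  #|[set c in C | A c.1 c.2 == d]| == 1.

Definition row_cells m n (i : 'I_m) : {set 'I_m * 'I_n} := [set c | c.1 == i].

Definition col_cells m n (j : 'I_n) : {set 'I_m * 'I_n} := [set c | c.2 == j].

(* Since c.1 %/ 3 = 0 when m = 3, the blocks of a band are those with a = 0. *)
Definition block_cells m n (a b : 'I_3) : {set 'I_m * 'I_n} :=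
  [set c : 'I_m * 'I_n | (c.1 %/ 3 == a) && (c.2 %/ 3 == b)].

Definition sudoku (S : grid) : bool :=
  [forall d, [&& [forall i, exactly_once S (row_cells 9 i) d],
                 [forall j, exactly_once S (col_cells 9 j) d] &
                 [forall a, forall b, exactly_once S (block_cells 9 9 a b) d]]].

Definition valid_band (G : band) : bool :=
  [forall d, [forall i, exactly_once G (row_cells 9 i) d] &&
             [forall b, exactly_once G (block_cells 3 9 ord0 b) d]].

Definition first_rows (S : grid) : band := rowsub (widen_ord (isT : 3 <= 9)) S.

Definition completions (G : band) : {set grid} :=
  [set S | sudoku S & first_rows S == G].

Definition col_digits (G : band) (j : 'I_9) : {set digit} :=
  [set G i j | i : 'I_3].

Definition col_partition (G : band) (b : 'I_3) : {set {set digit}} :=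
  [set col_digits G j | j : 'I_9 & j %/ 3 == b].

(* A finite multiset is represented by a sequence, with perm_eq as equality. *)
Definition col_partitions (G : band) : seq {set {set digit}} :=
  [seq col_partition G b | b <- enum 'I_3].

Definition relabel (s : {perm digit}) (P : {set {set digit}}) :
    {set {set digit}} :=
  [set [set s x | x in X] | X : {set digit} in P].

Definition multiset_iso (M M' : seq {set {set digit}}) : Prop :=
  exists s : {perm digit}, perm_eq [seq relabel s P | P <- M] M'.

(* Main.v *)
Require Import Defs.
From mathcomp Require Import all_boot all_algebra all_fingroup.

(** A completion of G is determined by its last six rows.  Let s be a
    relabelling of the digits and t a permutation of the columns that sends
    blocks to blocks, such that s carries the set of digits in column j of G
    to the set of digits in column t j of G'.  Applying s to the digits and t
    to the columns of the last six rows of a completion of G, and putting G'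
    on top, gives a completion of G'.  The point is that each house (row,
    column or block) needs from the last six rows exactly the digits which the
    band does not supply, and the band supplies to a house either nothing, or
    every digit, or, in the case of a column, a set of digits that s and t
    transport from G to G' ([occ_band_row], [occ_band_block], [occ_band_col]).
    This map [transplant] is injective, so G has at most as many completions
    as G' ([leq_completions]); the inverses of s and t give the converse
    inequality.

    An isomorphism between the multisets of column partitions produces such
    s and t ([matching_of_iso]): it matches the blocks of G with the blocks
    of G' in such a way that s carries one partition to the other, that is,
    columns to columns as sets of digits, and distinct columns of a block hold
    distinct sets of digits. *)

Set Implicit Arguments.
Unset Strict Implicit.
Unset Printing Implicit Defensive.

Definition occ m n (A : 'M[digit]_(m, n)) (C : {set 'I_m * 'I_n}) (d : digit) :=
  #|[set c in C | A c.1 c.2 == d]|.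

Definition in_grid (c : 'I_3 * 'I_9) : 'I_9 * 'I_9 :=
  (widen_ord (isT : 3 <= 9) c.1, c.2).

Definition top_cells : {set 'I_9 * 'I_9} := [set c : 'I_9 * 'I_9 | c.1 < 3].

Lemma in_grid_inj : injective in_grid.
Proof. by case=> i j [k l] [eq_ik ->]; congr pair; apply: val_inj. Qed.

Lemma occ_split (S : grid) C d :
  occ S C d = occ (first_rows S) (in_grid @^-1: C) d + occ S (C :\: top_cells) d.
Proof.
rewrite /occ -(cardsID top_cells); congr addn; last first.
  by apply: eq_card => c; rewrite !inE andbA.
rewrite -(card_imset _ in_grid_inj); apply: eq_card => -[i j].
rewrite !inE /=; apply/andP/imsetP => [[/andP[Cij Sij] lt_i3] | [[k l]]].
  have eq_ij : (i, j) = in_grid (Ordinal lt_i3, j).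
    by congr pair; apply: val_inj.
  exists (Ordinal lt_i3, j) => //; rewrite !inE -eq_ij Cij /= mxE.
  by rewrite (_ : widen_ord _ _ = i) //; apply: val_inj.
by rewrite !inE mxE /= => Ckl [-> ->]; rewrite Ckl /=.
Qed.

Lemma occ_band_row G i d :
  valid_band G -> occ G (in_grid @^-1: row_cells 9 i) d = (i < 3).
Proof.
move=> /forallP/(_ d)/andP[/forallP rowG _].
case: ltnP => [lt_i3 | le_3i].
  apply: etrans (eqP (rowG (Ordinal lt_i3))).
  by congr #|pred_of_set _|; apply/setP=> c; rewrite !inE.
by apply: eq_card0 => -[k l]; rewrite !inE -val_eqE /= ltn_eqF //
  (leq_trans _ le_3i).
Qed.

Lemma occ_band_block G a b d :
  valid_band G -> occ G (in_grid @^-1: block_cells 9 9 a b) d = (a == ord0).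
Proof.
move=> /forallP/(_ d)/andP[_ /forallP blockG].
have [-> | a_neq0] := eqVneq a ord0.
  apply: etrans (eqP (blockG b)).
  by congr #|pred_of_set _|; apply/setP=> c; rewrite !inE.
apply: eq_card0 => -[k l]; rewrite !inE /= divn_small //.
by rewrite eq_sym (negPf (a_neq0 : val a != 0)).
Qed.

Lemma valid_band_block_inj G i k (j l : 'I_9) :
  valid_band G -> j %/ 3 = l %/ 3 -> G i j = G k l -> (i, j) = (k, l).
Proof.
move=> /forallP/(_ (G i j))/andP[_ /forallP blockG] eq_jl eq_G.
have lt_j : j %/ 3 < 3 by rewrite ltn_divLR.
have /eqP/eq_leq/card_le1_eqP := blockG (Ordinal lt_j).
by apply; rewrite !inE /= divn_small //= -?eq_jl -?eq_G !eqxx.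
Qed.

(** A column of a band lies inside a block, so it cannot repeat a digit: the
    number of occurrences depends only on the set [col_digits G j].  This is
    why the order of the digits within a column does not matter. *)
Lemma occ_band_col G j d :
  valid_band G -> occ G (in_grid @^-1: col_cells 9 j) d = (d \in col_digits G j).
Proof.
move=> validG; case: imsetP => [[i _ ->] | no_d].
  apply/eqP/cards1P; exists (i, j); apply/setP=> -[k l]; rewrite !inE /=.
  apply/andP/eqP => [[/eqP-> /eqP eqG] | [-> ->] //].
  exact: (valid_band_block_inj validG).
apply: eq_card0 => -[k l]; rewrite !inE /=; apply/andP=> -[/eqP-> /eqP eqG].
by case: no_d; exists k.
Qed.

(** That t sends blocks to blocks is expressed by a permutation p of the
    blocks, which makes the relation visibly symmetric. *)
Definition matching (s : {perm digit}) (t : {perm 'I_9}) (p : {perm 'I_3})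
    (G G' : band) : Prop :=
  (forall j b, (t j %/ 3 == p b) = (j %/ 3 == b)) /\
  (forall j d, (s d \in col_digits G' (t j)) = (d \in col_digits G j)).

Lemma matching_sym s t p G G' :
  matching s t p G G' -> matching s^-1%g t^-1%g p^-1%g G' G.
Proof.
case=> blk cols; split=> [j b|j d].
  by rewrite -blk !permKV.
by rewrite -cols !permKV.
Qed.

Definition transplant (s : {perm digit}) (t : {perm 'I_9}) (G' : band)
    (S : grid) : grid :=
  \matrix_(i, j) if i < 3 then G' (inord i) j else s (S i (t^-1 j)%g).

Definition move_col (t : {perm 'I_9}) (c : 'I_9 * 'I_9) := (c.1, t c.2).

Section Transplant.

Variables (s : {perm digit}) (t : {perm 'I_9}) (p : {perm 'I_3}) (G G' : band).
Hypotheses (validG : valid_band G) (validG' : valid_band G').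
Hypothesis matchGG' : matching s t p G G'.

Lemma first_rows_transplant S : first_rows (transplant s t G' S) = G'.
Proof.
by apply/matrixP=> i j; rewrite !mxE /= ltn_ord inord_val.
Qed.

Lemma occ_bottom_transplant S C d :
  occ (transplant s t G' S) (C :\: top_cells) (s d)
  = occ S ((move_col t @^-1: C) :\: top_cells) d.
Proof.
have t_inj : injective (move_col t).
  by case=> i j [k l] [-> /perm_inj->].
rewrite /occ -[RHS](card_imset _ t_inj); apply: eq_card => -[i j].
rewrite -[j](permKV t); set l := (t^-1)%g j.
rewrite -[(i, t l)]/(move_col t (i, l)) (mem_imset _ _ t_inj).
rewrite !inE /= mxE permK; case: ltnP => //= _.
by rewrite (inj_eq perm_inj).
Qed.

(** The last six rows correspond cell by cell, so only the contributions of
    the two bands to C and to its preimage have to be compared. *)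
Lemma exactly_once_transplant S (C : {set _}) d :
  first_rows S = G ->
  occ G' (in_grid @^-1: C) (s d)
    = occ G (in_grid @^-1: (move_col t @^-1: C)) d ->
  exactly_once (transplant s t G' S) C (s d)
  = exactly_once S (move_col t @^-1: C) d.
Proof.
move=> SG eq_top; rewrite /exactly_once -!/(occ _ _ _).
rewrite (occ_split (transplant _ _ _ _)) (occ_split S).
by rewrite occ_bottom_transplant first_rows_transplant SG eq_top.
Qed.

Lemma transplant_completion S :
  S \in completions G -> transplant s t G' S \in completions G'.
Proof.
have [blk cols] := matchGG'.
rewrite !inE first_rows_transplant eqxx andbT => /andP[/forallP sudS /eqP SG].
apply/forallP=> d; rewrite -(permKV s d); set e := (s^-1)%g d.
have /and3P[/forallP rowS /forallP colS /forallP blockS] := sudS e.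
apply/and3P; split; apply/forallP.
- move=> i; have eqC : move_col t @^-1: row_cells 9 i = row_cells 9 i.
    by apply/setP=> c; rewrite !inE.
  by rewrite exactly_once_transplant // eqC // !occ_band_row.
- move=> j; rewrite -(permKV t j); set l := (t^-1)%g j.
  have eqC : move_col t @^-1: col_cells 9 (t l) = col_cells 9 l.
    by apply/setP=> c; rewrite !inE (inj_eq perm_inj).
  by rewrite exactly_once_transplant // eqC // !occ_band_col // cols.
move=> a; apply/forallP=> b; rewrite -(permKV p b); set b0 := (p^-1)%g b.
have eqC : move_col t @^-1: block_cells 9 9 a (p b0) = block_cells 9 9 a b0.
  by apply/setP=> c; rewrite !inE /= blk.
rewrite exactly_once_transplant // eqC ?occ_band_block //.
exact: (forallP (blockS a)).
Qed.

(** The overwritten top rows lose nothing: they equal G in every completion. *)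
Lemma transplant_inj : {in completions G &, injective (transplant s t G')}.
Proof.
move=> S T; rewrite !inE => /andP[_ /eqP SG] /andP[_ /eqP TG] eqST.
apply/matrixP=> i j; have [lt_i3 | le_3i] := ltnP i 3.
  have /matrixP/(_ (Ordinal lt_i3) j) : first_rows S = first_rows T by rewrite SG.
  by rewrite !mxE (_ : widen_ord _ _ = i) //; apply: val_inj.
have /matrixP/(_ i (t j)) := eqST.
by rewrite !mxE ltnNge le_3i /= permK => /perm_inj.
Qed.

Lemma leq_completions : #|completions G| <= #|completions G'|.
Proof.
rewrite -(card_in_imset transplant_inj); apply/subset_leq_card/subsetP.
by move=> _ /imsetP[S SG ->]; apply: transplant_completion.
Qed.

End Transplant.

Lemma col_digits_inj G (j l : 'I_9) :
  valid_band G -> j %/ 3 = l %/ 3 -> col_digits G j = col_digits G l -> j = l.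
Proof.
move=> validG eq_blk eq_dig.
have: G ord0 j \in col_digits G l by rewrite -eq_dig; apply: imset_f.
by case/imsetP=> k _ /(valid_band_block_inj validG eq_blk)[].
Qed.

Lemma matching_of_iso G G' :
  valid_band G -> multiset_iso (col_partitions G) (col_partitions G') ->
  exists s t p, matching s t p G G'.
Proof.
move=> validG [s]; rewrite /col_partitions -map_comp => iso.
(* Equality of multisets, read on families indexed by the three blocks. *)
have [p eq_p] : exists p : {perm 'I_3},
    forall b, relabel s (col_partition G b) = col_partition G' (p b).
  have /tuple_permP[p eq_p] :
      perm_eq [tuple relabel s (col_partition G b) | b < 3]
              [tuple col_partition G' b | b < 3] by [].
  exists p => b; have /(congr1 (fun u => tnth u b)) := val_inj eq_p.
  by rewrite !tnth_mktuple.
have blk (j : 'I_9) : j %/ 3 < 3 by rewrite ltn_divLR.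
have /fin_all_exists[f fP] (j : 'I_9) : exists l : 'I_9,
    l %/ 3 = p (Ordinal (blk j)) /\ col_digits G' l = s @: col_digits G j.
  have: s @: col_digits G j \in col_partition G' (p (Ordinal (blk j))).
    by rewrite -eq_p; apply/imset_f/imset_f; rewrite inE.
  by case/imsetP=> l /[!inE] /eqP ? ->; exists l.
have f_inj : injective f.
  move=> j l eq_f; have [blk_j dig_j] := fP j; have [blk_l dig_l] := fP l.
  apply: (col_digits_inj validG).
    move: blk_j; rewrite eq_f blk_l => /val_inj/perm_inj.
    by move/(congr1 val).
  by apply: (imset_inj (@perm_inj _ s)); rewrite -dig_j -dig_l eq_f.
exists s, (perm f_inj), p; split=> [j b|j d]; rewrite permE.
  by rewrite (fP j).1 val_eqE (inj_eq perm_inj).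
by rewrite (fP j).2 (mem_imset _ _ perm_inj).
Qed.

Theorem theorem1 (G G' : band) (hG : valid_band G) (hG' : valid_band G')
    (hiso : multiset_iso (col_partitions G) (col_partitions G')) :
  #|completions G| = #|completions G'|.
Proof.
have [s [t [p match_st]]] := matching_of_iso hG hiso.
apply/eqP; rewrite eqn_leq (leq_completions hG hG' match_st).
exact: leq_completions hG' hG (matching_sym match_st).
Qed.
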